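(* Let $X$ be any subdomain of the unit disk $\Delta$ that is not relatively compact in $\Delta$. Then there exists a sequence $(f_n)_{n\geq 1}$ of holomorphic mappings from $\Delta$ to $X$ such that the iterated function system $F_n=f_1\circ f_2\circ\cdots\circ f_n$ has more than one accumulation point.
   Context: $\Delta=\{z\in\mathbb{C}:|z|<1\}$. A subdomain of $\Delta$ is a nonempty connected open subset of $\Delta$ (possibly $\Delta$ itself). $X$ is relatively compact in $\Delta$ if its closure in $\mathbb{C}$ is a compact subset of $\Delta$. An accumulation point of the sequence $(F_n)$ is a holomorphic function $F$ on $\Delta$ that is the limit, uniformly on compact subsets of $\Delta$, of some subsequence of $(F_n)$. *)

(* Defs.v *)
From HB Require Import structures.
From mathcomp Require Import all_boot all_order all_algebra complex.
From mathcomp Require Import all_classical all_reals all_analysis.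

Set Implicit Arguments.
Unset Strict Implicit.
Unset Printing Implicit Defensive.

Import Order.TTheory GRing.Theory Num.Theory.
Import numFieldNormedType.Exports.

Local Open Scope classical_set_scope.
Local Open Scope ring_scope.

(* The complex plane as a normed module over itself: the topology is attached
   to the regular algebra [R[i]^o] and not to [R[i]], and scalars being complex,
   [derivable] is complex differentiability. *)
Notation Cplane R := (complex R)^o.

Section Definitions.
Variable R : realType.
Local Notation C := (Cplane R).

Definition unit_disk : set C := [set z | `|z| < 1].

Definition subdomain (D X : set C) : Prop :=
  [/\ X `<=` D, X !=set0, open X & connected X].

Definition relatively_compact_in (D X : set C) : Prop :=
  compact (closure X) /\ closure X `<=` D.

(* Functions are total; their values outside the (open) set [D] are irrelevant
   here and in the definitions below. *)
Definition holomorphic_on (D : set C) (f : C -> C) : Prop :=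
  forall z, D z -> derivable f z 1.

Definition holomorphic_map (D X : set C) (f : C -> C) : Prop :=
  holomorphic_on D f /\ (forall z, D z -> X (f z)).

(* Indices are shifted by one: [f n] is the map written f_(n+1) on paper, so
   that [ifs f n] is f_1 o f_2 o ... o f_(n+1). *)
Fixpoint ifs (f : nat -> C -> C) (n : nat) : C -> C :=
  if n is m.+1 then ifs f m \o f m.+1 else f 0%N.

Definition accumulation_point (D : set C) (F : nat -> C -> C) (G : C -> C) :
    Prop :=
  holomorphic_on D G /\
  exists2 s : nat -> nat, {homo s : m n / (m < n)%N} &
    forall K : set C, compact K -> K `<=` D ->
      {uniform K, F \o s @ \oo --> G}.

(* Two accumulation points are the same when they agree on [D]. *)
Definition more_than_one_accumulation_point (D : set C) (F : nat -> C -> C) :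
    Prop :=
  exists G H : C -> C, [/\ accumulation_point D F G, accumulation_point D F H
    & exists2 z, D z & G z != H z].

End Definitions.

Arguments unit_disk R : clear implicits.

(* Main.v *)
Require Import Defs.
From mathcomp Require Import all_boot all_order all_algebra complex.
From mathcomp Require Import all_classical all_reals all_analysis.
From mathcomp Require Import ring lra.

(** Composing on the right, as in F_(n+1) = F_n o f_(n+1), never enlarges the
    image, and yet the system can be made to oscillate: two points a <> b of X
    are fixed, and the maps are built so that F_n is nearly constant on a large
    disk, with value alternately a and b, while both values are still attained
    at points of X.

    Suppose F_n takes the values a and b at points x and y of X.  It suffices
    to find f_(n+1) : Delta -> X which is nearly equal to x on |z| <= r (so
    that F_(n+1) is nearly a there), fixes x, and takes the value y at some
    point y' of X; then one exchanges the roles of a and b and takes r closer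
    to 1 ([pinching_map], [oscillating_ifs]).  The map f_(n+1) is g o p, where:

    - g : Delta -> X satisfies g(0) = x and g(w) = y for some w in Delta
      ([disc_link]).  This g is a polynomial, obtained by successive
      corrections.  The set of points y that can be reached by such a disc,
      with g mapping the closed disk into X, with g(1) = y and with some room
      left around the image, contains with y any ball about y included in X:
      to move the endpoint by v, one adds
      z ((1 + z) / 2)^(2n) v to g, a term that is small away from 1 and that
      is of modulus at most |v| near 1, where g is close to y
      ([closed_disc_link_add]).  That set is thus open and closed in X, and X
      is connected.

    - p maps Delta into Delta, is small on |z| <= r and satisfies p(x) = 0 and
      p(y') = w for some y' in X ([interpolation]).  This is where X has to
      reach the unit circle: y' cannot lie in the disk |z| <= r, where p is
      small.  Since x^n is small for large n, p(z) = w (z^n - x^n) /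
      (y'^n - x^n) works as soon as |y'|^n is close to 1.

    So the maps f_n are polynomials, and the two limits are the constants a and
    b. *)

Set Implicit Arguments.
Unset Strict Implicit.
Unset Printing Implicit Defensive.

Import Order.TTheory GRing.Theory Num.Theory Normc.
Import numFieldNormedType.Exports.

Local Open Scope classical_set_scope.
Local Open Scope ring_scope.

(** * The topology of the plane through the real-valued modulus *)

Section ComplexPlane.
Variable R : realType.
Local Notation C := (Cplane R).
Implicit Types (x y z w : C) (f g : C -> C).

Lemma normE z : `|z| = (normc z)%:C%C.
Proof. by []. Qed.

Lemma normc_ge0 z : 0 <= normc z.
Proof. by rewrite -lecR -normE normr_ge0. Qed.

Lemma normcD z w : normc (z + w) <= normc z + normc w.
Proof. exact: le_normcD. Qed.

Lemma normcB z w : normc (z - w) <= normc z + normc w.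
Proof. by rewrite -[normc w]normcN; exact: normcD. Qed.

Lemma normc_sub_sym z w : normc (z - w) = normc (w - z).
Proof. by rewrite -normcN opprB. Qed.

Lemma normcX z n : normc (z ^+ n) = normc z ^+ n.
Proof.
elim: n => [|n IHn]; first exact: normc1.
by rewrite !exprS [LHS]normcM IHn.
Qed.

Lemma normc_real (r : R) : 0 <= r -> normc (r%:C%C : C) = r.
Proof. by move=> r0; rewrite /= expr0n addr0 sqrtr_sqr ger0_norm. Qed.

Lemma unit_diskE z : unit_disk R z = (normc z < 1) :> Prop.
Proof. by rewrite /unit_disk /= normE (ltcR _ 1). Qed.

(** In a normed module over the complex numbers, the radii of balls are complex
    too, and the order on them is only partial; real radii allow linear
    arithmetic. *)
Lemma nbhs_normcP z (U : set C) :
  nbhs z U <-> exists2 e : R, 0 < e & forall w, normc (w - z) < e -> U w.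
Proof.
split => [/nbhs_ballP [e /= e0 zU]|[e e0 zU]].
  have eE : e = (complex.Re e)%:C%C by rewrite RRe_real ?gtr0_real.
  move: e0; rewrite eE ltcR => e0; exists (complex.Re e) => // w zw; apply: zU.
  by rewrite /ball /= eE distrC normE ltcR.
apply/nbhs_ballP; exists (e%:C%C); first by rewrite /= ltcR.
by move=> w; rewrite /ball /= distrC normE ltcR => /zU.
Qed.

Lemma open_normcP (U : set C) z : open U -> U z ->
  exists2 e : R, 0 < e & forall w, normc (w - z) < e -> U w.
Proof. by move=> oU Uz; apply/nbhs_normcP/open_nbhs_nbhs. Qed.

(** Entire functions, rather than functions that are holomorphic on a domain,
    so that sums, products and composites need no side condition. *)
Definition entire f := holomorphic_on setT f.

Lemma entire_differentiable f : entire f <-> forall z, differentiable f z.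
Proof.
split=> [ef z|df z _]; first by apply/derivable1_diffP/ef.
exact/derivable1_diffP/df.
Qed.

Lemma entire_cst c : entire (fun=> c).
Proof. by apply/entire_differentiable => z; exact: differentiable_cst. Qed.

Lemma entire_id : entire id.
Proof. by move=> z _; exact: derivable_id. Qed.

Lemma entireD f g (ef : entire f) (eg : entire g) : entire (fun z => f z + g z).
Proof.
move: ef eg => /entire_differentiable df /entire_differentiable dg.
by apply/entire_differentiable => z; exact: differentiableD.
Qed.

Lemma entireM f g (ef : entire f) (eg : entire g) : entire (fun z => f z * g z).
Proof.
move: ef eg => /entire_differentiable df /entire_differentiable dg.
by apply/entire_differentiable => z; exact: differentiableM.
Qed.

Lemma entireX n f (ef : entire f) : entire (fun z => f z ^+ n).
Proof.
elim: n => [|n IHn]; first exact: entire_cst.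
by under eq_fun do rewrite exprS; exact: entireM.
Qed.

Lemma entire_comp f g (ef : entire f) (eg : entire g) : entire (f \o g).
Proof.
move: ef eg => /entire_differentiable df /entire_differentiable dg.
by apply/entire_differentiable => z; exact: differentiable_comp.
Qed.

Lemma entire_continuousP f z (e : R) : entire f -> 0 < e ->
  exists2 d : R, 0 < d & forall w, normc (w - z) < d -> normc (f w - f z) < e.
Proof.
move=> /entire_differentiable /(_ z) /differentiable_continuous cf e0.
apply/nbhs_normcP; apply: (cf [set w | normc (w - f z) < e]).
by apply/nbhs_normcP; exists e.
Qed.

Lemma compact_unit_square :
  compact [set z : C | `|complex.Re z| <= 1 /\ `|complex.Im z| <= 1].
Proof.
have cI : compact `[(-1 : R), 1] by exact: segment_compact.
have -> : [set z : C | `|complex.Re z| <= 1 /\ `|complex.Im z| <= 1] =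
    (fun p : R * R => (p.1 +i* p.2)%C : C) @`
    (`[(-1 : R), 1] `*` `[(-1 : R), 1]).
  apply/seteqP; split => [[a b] /= [a1 b1]|_ [[a b] /= [a1 b1] <-]] /=.
    by exists (a, b) => //; split; rewrite /= in_itv /= -ler_norml.
  by rewrite !ler_norml; split; [move: a1|move: b1]; rewrite in_itv.
apply: continuous_compact; last exact: compact_setX.
apply: continuous_subspaceT => -[a b] U /nbhs_normcP [e e0 eU].
have e20 : 0 < e / 2 by rewrite divr_gt0.
exists (ball a (e / 2), ball b (e / 2)).
  by split; exact: nbhsx_ballx.
move=> [a' b'] /= [aa bb]; apply: eU.
rewrite /ball /= in aa bb.
have -> : ((a' +i* b')%C : C) - (a +i* b)%C =
          (a' - a)%:C%C + 'i%C * (b' - b)%:C%C.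
  by apply/eqP; rewrite eq_complex /=; apply/andP; split; apply/eqP; ring.
apply: le_lt_trans (normcD _ _) _.
rewrite [normc ('i%C * _)]normcM /= !expr0n !expr1n /= !(addr0, add0r).
rewrite sqrtr1 mul1r.
rewrite !sqrtr_sqr distrC [`|b' - b|]distrC; lra.
Qed.

(** Non-relative compactness is used only in this form.  If the modulus were
    bounded by r < 1 on X, it would be on the closure of X, which would then be
    compact by the Heine-Borel theorem and contained in the disk. *)
Lemma escapes_compact (X : set C) : X `<=` unit_disk R ->
  ~ relatively_compact_in (unit_disk R) X ->
  forall r : R, r < 1 -> exists2 z, X z & r < normc z.
Proof.
move=> XD nrc r r1; apply: contrapT => hX; apply: nrc.
have Xr z : X z -> normc z <= r.
  by move=> Xz; rewrite leNgt; apply/negP => rz; apply: hX; exists z.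
have clXr z : closure X z -> normc z <= r.
  move=> clXz; rewrite leNgt; apply/negP => rz.
  have [] := clXz [set w | normc (w - z) < normc z - r].
    by apply/nbhs_normcP; exists (normc z - r) => //; rewrite subr_gt0.
  move=> w [/Xr wr /=]; rewrite normc_sub_sym => wz.
  have := normcD (z - w) w; rewrite subrK; lra.
split=> [|z /clXr zr]; last by rewrite unit_diskE; exact: le_lt_trans r1.
apply: subclosed_compact compact_unit_square _; first exact: closed_closure.
move=> z /clXr zr /=.
have zR : normc z <= 1 by lra.
have ReIm a b : `|a| <= normc (a +i* b : C)%C /\ `|b| <= normc (a +i* b : C)%C.
  rewrite /= -!sqrtr_sqr; split; rewrite ler_sqrt ?addr_ge0 ?sqr_ge0 //.
    by rewrite lerDl sqr_ge0.
  by rewrite lerDr sqr_ge0.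
case: z zR {zr} => a b zR.
by have [ha hb] := ReIm a b; split; apply: le_trans zR.
Qed.

(** The precision of the n-th map of the system and the size of the disk on
    which it is achieved are governed by the same sequence 1 / (n + 1); this is
    the exhaustion of the disk by closed disks that corresponds to it. *)
Lemma compact_in_disk (K : set C) : compact K -> K `<=` unit_disk R ->
  \forall n \near \oo, forall z, K z -> normc z <= 1 - n.+1%:R^-1.
Proof.
move=> /compact_near_coveringP cK KD.
apply: (cK nat \oo (fun n z => normc z <= 1 - n.+1%:R^-1)) => z Kz.
have z1 : normc z < 1 by rewrite -unit_diskE; exact: KD.
have d0 : 0 < (1 - normc z) / 2 by rewrite divr_gt0 // subr_gt0.
exists ([set w | normc (w - z) < (1 - normc z) / 2],
        [set n | (n.+1%:R^-1 : R) < (1 - normc z) / 2]).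
  split; first by apply/nbhs_normcP; exists ((1 - normc z) / 2).
  exact: near_infty_natSinv_lt (PosNum d0).
move=> [w n] /= [wz nz].
have := normcD (w - z) z; rewrite subrK.
move: (normc (w - z)) (normc w) wz (n.+1%:R^-1) nz => u v uz i iz; lra.
Qed.

End ComplexPlane.

Arguments entire {R} f.
Arguments entire_cst {R} c.
Arguments entire_id {R}.
Arguments entireD {R f g} ef eg.
Arguments entireM {R f g} ef eg.
Arguments entireX {R} n {f} ef.
Arguments entire_comp {R f g} ef eg.

(** * Discs joining two points of a connected open set *)

Section Discs.
Variable R : realType.
Local Notation C := (Cplane R).
Implicit Types (x y z w : C) (f g : C -> C) (X : set C).

Lemma exists_exp_lt (q e : R) : 0 <= q < 1 -> 0 < e ->
  exists2 n, (0 < n)%N & q ^+ n < e.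
Proof.
move=> /andP[q0 q1] e0.
have : q ^+ n @[n --> \oo] --> (0 : R) by apply: cvg_expr; rewrite ger0_norm.
move=> /cvgrPdist_lt /(_ _ e0) [m _ /(_ m.+1 (leqnSn m))] /=.
by rewrite sub0r normrN ger0_norm ?exprn_ge0 // => h; exists m.+1.
Qed.

(** The point 1 is a peak point of (1 + z) / 2 on the closed disk; this
    quantitative form is the parallelogram law for z and 1. *)
Lemma normc_half_add1 z : normc z <= 1 ->
  normc ((1 + z) * 2^-1%:C%C) ^+ 2 <= 1 - normc (z - 1) ^+ 2 / 4.
Proof.
rewrite [normc (_ * _)]normcM normc_real ?invr_ge0 // exprMn.
have sq (a b : R) : normc (a +i* b : C)%C ^+ 2 = a ^+ 2 + b ^+ 2.
  by rewrite sqr_sqrtr // addr_ge0 ?sqr_ge0.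
move=> z1; have : normc z ^+ 2 <= 1 by rewrite expr_le1 ?normc_ge0.
case: z {z1} => a b.
have -> : 1 + (a +i* b)%C = ((1 + a) +i* b)%C :> C.
  by apply/eqP; rewrite eq_complex /= add0r !eqxx.
have -> : (a +i* b)%C - 1 = ((a - 1) +i* b)%C :> C.
  by apply/eqP; rewrite eq_complex /= subr0 !eqxx.
by rewrite !sq; nra.
Qed.

(** The margin e makes the class of these discs stable under small
    perturbations. *)
Definition closed_disc_link X x y :=
  exists f, [/\ entire f,
    exists2 e : R, 0 < e &
      forall z (u : C), normc z <= 1 -> normc u <= e -> X (f z + u),
    f 0 = x & f 1 = y].

Lemma closed_disc_link_refl X x : open X -> X x -> closed_disc_link X x x.
Proof.
move=> oX /(open_normcP oX)[e e0 eX]; exists (fun=> x).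
split; [exact: entire_cst| |by []|by []].
exists (e / 2); first by rewrite divr_gt0.
by move=> z u _ ue; apply: eX; rewrite addrC addKr; lra.
Qed.

(** The radius d bears no relation to the margin of the given disc, so that one
    cannot just add z * v.  The correction is concentrated near 1, where the
    disc stays in the ball about y; elsewhere a high power makes it smaller than
    the margin. *)
Lemma closed_disc_link_add X x y v (d : R) :
    closed_disc_link X x y -> (forall u, normc u < d -> X (y + u)) ->
  normc v < d -> closed_disc_link X x (y + v).
Proof.
move=> [f [ef [e e0 eX] f0 f1]] dX vd.
have d0 : 0 < d by apply: le_lt_trans (normc_ge0 v) vd.
(* Near 1, the distance to y is at most |v| plus an error c for the continuity
   of f and a new margin c, which is less than d. *)
pose c := (d - normc v) / 3.
have c0 : 0 < c by rewrite divr_gt0 // subr_gt0.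
have [t0 t00 t0f] := entire_continuousP 1 ef c0.
(* The bound by 1 keeps the ratio q below nonnegative. *)
pose t := Num.min t0 1.
have tt : 0 < t <= 1 by rewrite /t lt_min t00 ltr01 ge_min lexx orbT.
have tf w : normc (w - 1) < t -> normc (f w - y) < c.
  by rewrite -f1 lt_min => /andP[/t0f].
pose q := 1 - t ^+ 2 / 4.
have q01 : 0 <= q < 1 by rewrite /q; apply/andP; split; nra.
have ed0 : 0 < e / (2 * d) by rewrite divr_gt0 ?mulr_gt0.
have [n _ qn] := exists_exp_lt q01 ed0.
pose p z : C := z * (((1 + z) * 2^-1%:C%C) ^+ 2) ^+ n.
have pn z : normc z <= 1 -> normc (p z) <= 1.
  move=> z1; rewrite [normc _]normcM 2!normcX.
  rewrite mulr_ile1 ?exprn_ge0 ?normc_ge0 //.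
  rewrite exprn_ile1 ?exprn_ge0 ?normc_ge0 //.
  by apply: le_trans (normc_half_add1 z1) _; rewrite gerBl divr_ge0 ?sqr_ge0.
have pfar z : normc z <= 1 -> t <= normc (z - 1) -> normc (p z) <= q ^+ n.
  move=> z1 tz; rewrite [normc _]normcM 2!normcX -[leRHS]mul1r.
  rewrite ler_pM ?exprn_ge0 ?normc_ge0 //.
  have q0 : 0 <= q by case/andP: q01.
  rewrite lerXn2r ?nnegrE ?exprn_ge0 ?normc_ge0 //.
  apply: le_trans (normc_half_add1 z1) _.
  rewrite lerD2l lerN2 ler_pM2r ?invr_gt0 // lerXn2r ?nnegrE ?normc_ge0 //; lra.
exists (fun z => f z + p z * v); split.
- have eh := entireM (entireD (entire_cst 1) entire_id)
                     (entire_cst ((2^-1 : R)%:C%C : C)).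
  have ep := entireM entire_id (entireX n (entireX 2 eh)).
  exact (entireD ef (entireM ep (entire_cst v))).
- exists (Num.min (e / 2) c); first by rewrite lt_min c0 divr_gt0.
  move=> z u z1; rewrite le_min => /andP[ue uc].
  have [tz|zt] := leP t (normc (z - 1)).
    rewrite -addrA; apply: eX => //; apply: le_trans (normcD _ _) _.
    rewrite [normc (_ * _)]normcM.
    have : normc (p z) * normc v <= q ^+ n * d.
      by rewrite ler_pM ?normc_ge0 ?pfar // ltW.
    have : q ^+ n * d <= e / (2 * d) * d by rewrite ler_pM2r // ltW.
    have -> : e / (2 * d) * d = e / 2 by field; rewrite gt_eqF.
    lra.
  have -> : f z + p z * v + u = y + ((f z - y) + p z * v + u) by ring.
  apply: dX; apply: le_lt_trans (normcD _ _) _.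
  have := normcD (f z - y) (p z * v); rewrite [normc (p z * v)]normcM.
  have := tf _ zt; have : normc (p z) * normc v <= normc v.
    by rewrite ler_piMl ?normc_ge0 ?pn.
  have : 3 * c = d - normc v by rewrite /c; field.
  lra.
- by rewrite /p mul0r mul0r addr0.
- rewrite f1 /p mul1r; congr (_ + _).
  have -> : ((1 + 1) * 2^-1%:C%C : C) = 1.
    by apply/eqP; rewrite eq_complex /=; apply/andP; split; apply/eqP; field.
  by rewrite !expr1n mul1r.
Qed.

(** The set of the points that are linked to x is open in X by
    [closed_disc_link_add].  It is closed in X for the same reason: the radius
    of the allowed move depends only on the endpoint, and not on the disc, so
    that a limit point is reached from a linked point close enough to it. *)
Lemma connected_closed_disc_link X x y : open X -> connected X ->
  X x -> X y -> closed_disc_link X x y.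
Proof.
move=> oX cX Xx Xy; pose S := [set y | X y /\ closed_disc_link X x y].
suff : S = X by move=> SX; have [] : S y by rewrite SX.
have link_ball z w (d : R) : (forall u, normc (u - z) < d -> X u) ->
    closed_disc_link X x z -> normc (w - z) < d -> closed_disc_link X x w.
  move=> dX xz wz; rewrite -[w](subrK z) addrC.
  apply: (@closed_disc_link_add _ _ _ _ d) => // u ud.
  by apply: dX; rewrite addrC addKr.
apply: cX.
- by exists x; split => //; exact: closed_disc_link_refl.
- exists S; last by apply/seteqP; split => z; [case|case].
  rewrite openE => z [Xz xz]; have [d d0 dX] := open_normcP oX Xz.
  apply/nbhs_normcP; exists d => // w wz; split; first exact: dX.
  exact: link_ball xz wz.
- exists (closure S); first exact: closed_closure.
  apply/seteqP; split => [z Sz|z [Xz clSz]].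
    by split; [case: Sz|exact: subset_closure].
  split=> //; have [d d0 dX] := open_normcP oX Xz.
  have d20 : 0 < d / 2 by rewrite divr_gt0.
  have [|w [[Xw xw] wz]] := clSz [set w | normc (w - z) < d / 2].
    by apply/nbhs_normcP; exists (d / 2).
  rewrite /= in wz.
  apply: (link_ball w z (d / 2)) => //; last by rewrite normc_sub_sym.
  move=> u uw; apply: dX; have := normcD (u - w) (w - z).
  by rewrite addrA subrK; lra.
Qed.

(** Unlike in [closed_disc_link], the endpoint y is reached at an interior point
    of the disk, so that it can be the value of a self-map of the disk: f is
    close to y at a point w of the disk close to 1, and a small linear term,
    allowed by the margin, corrects the error. *)
Lemma disc_link X x y : open X -> connected X -> X x -> X y ->
  exists f w, [/\ entire f, forall z, normc z <= 1 -> X (f z), normc w < 1,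
    f 0 = x & f w = y].
Proof.
move=> oX cX Xx Xy.
have [f [ef [e e0 eX] f0 f1]] := connected_closed_disc_link oX cX Xx Xy.
have e20 : 0 < e / 2 by rewrite divr_gt0.
have [t t0 tf] := entire_continuousP 1 ef e20.
(* With s >= 1/2, dividing the error by s at most doubles it. *)
pose s := 1 - Num.min (t / 2) (2^-1).
have [s2 s1 st] : [/\ 2^-1 <= s, s < 1 & 1 - s < t].
  rewrite /s; have : 0 < Num.min (t / 2) (2^-1) by rewrite lt_min divr_gt0 //=.
  have : Num.min (t / 2) 2^-1 <= t / 2 by rewrite ge_min lexx.
  have : Num.min (t / 2) 2^-1 <= 2^-1 by rewrite ge_min lexx orbT.
  by split; lra.
have s0 : s != 0 by rewrite gt_eqF //; lra.
pose w : C := s%:C%C; pose v : C := (y - f w) * s^-1%:C%C.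
have ve : normc v <= e.
  rewrite [normc _]normcM normc_real ?invr_ge0; last by lra.
  have : normc (y - f w) < e / 2.
    rewrite -f1 normc_sub_sym; apply: tf.
    by rewrite normc_sub_sym -[1]/(1%:C%C) -rmorphB normc_real //; lra.
  have : s^-1 <= 2 by rewrite invf_ple ?posrE //; lra.
  have : 0 <= s^-1 by rewrite invr_ge0; lra.
  have := normc_ge0 (y - f w); nra.
exists (fun z => f z + z * v), w; split.
- exact (entireD ef (entireM entire_id (entire_cst v))).
- move=> z z1; apply: eX => //; rewrite [normc _]normcM.
  by apply: le_trans ve; rewrite ler_piMl ?normc_ge0.
- by rewrite normc_real //; lra.
- by rewrite mul0r addr0.
- rewrite /v mulrCA /w -rmorphM divff // mulr1 addrC subrK //.
Qed.

(** * The oscillating system *)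

Lemma bernoulli_le (t : R) n : 0 <= t <= 1 -> 1 - n%:R * t <= (1 - t) ^+ n.
Proof.
move=> /andP[t0 t1]; elim: n => [|n IHn]; first by rewrite mul0r subr0.
rewrite exprS -natr1; have : 0 <= n%:R * t * t by rewrite !mulr_ge0.
have := ler_wpM2l (_ : 0 <= 1 - t) IHn; rewrite subr_ge0 => /(_ t1); lra.
Qed.

(** An explicit self-map of the disk that flattens a large disk to 0, although
    it takes the prescribed values 0 and w on X. *)
Lemma interpolation X x w (r e : R) :
    X `<=` unit_disk R -> ~ relatively_compact_in (unit_disk R) X ->
    X x -> normc w < 1 -> r < 1 -> 0 < e ->
  exists f y, [/\ entire f, X y, f x = 0, f y = w &
    forall z, (normc z < 1 -> normc (f z) < 1) /\
              (normc z <= r -> normc (f z) < e)].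
Proof.
move=> XD nrc Xx w1 r1 e0.
have esc := escapes_compact XD nrc.
have disk1 z : X z -> normc z < 1 by move=> /XD; rewrite unit_diskE.
have x1 := disk1 _ Xx; set rho := normc w in w1.
have rho0 : 0 <= rho := normc_ge0 w.
(* If |x^n| < d and |y^n| >= 1 - d, the modulus of f is at most
   rho (1 + d) / (1 - 2 d) on the disk, and 2 rho d / (1 - 2 d) where |z^n| < d;
   the first bound on d makes the former less than 1, the second one the
   latter less than e. *)
pose d := Num.min ((1 - rho) / 4) (e / 4).
have [d0 drho de] : [/\ 0 < d, d <= (1 - rho) / 4 & d <= e / 4].
  by rewrite /d lt_min !ge_min !lexx orbT !divr_gt0 // subr_gt0.
pose m := Num.max r (normc x).
have m01 : 0 <= m < 1 by rewrite /m le_max normc_ge0 orbT gt_max r1.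
have [n n0 mn] := exists_exp_lt m01 d0.
have small z : normc z <= m -> normc (z ^+ n) < d.
  move=> zm; apply: le_lt_trans mn.
  rewrite normcX lerXn2r ?nnegrE ?normc_ge0 //.
  by case/andP: m01.
have xn : normc (x ^+ n) < d by apply: small; rewrite le_max lexx orbT.
have n0R : 0 < n%:R :> R by rewrite ltr0n.
(* By the Bernoulli inequality, this bound on |y| entails |y|^n >= 1 - d. *)
have [y Xy dy] := esc (1 - d / n%:R) ltac:(by rewrite gtrBl divr_gt0).
have yn : 1 - d <= normc (y ^+ n).
  rewrite normcX; have n1 : 1 <= n%:R :> R by rewrite ler1n.
  have dn : d / n%:R <= d by rewrite ler_pdivrMr // ler_peMr // ltW.
  have dn0 : 0 <= d / n%:R by rewrite divr_ge0 // ltW.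
  have := @bernoulli_le (d / n%:R) n.
  rewrite mulrCA divff ?gt_eqF // mulr1 => /(_ _)/le_trans; apply.
    by apply/andP; split; lra.
  by rewrite lerXn2r ?nnegrE ?normc_ge0 ?ltW //; lra.
pose D : C := y ^+ n - x ^+ n.
have DD : 1 - 2 * d < normc D.
  by have := normcD D (x ^+ n); rewrite subrK; lra.
have D0 : D != 0 by apply/eqP => D0; move: DD; rewrite D0 [normc 0]normc0; lra.
have normf z : normc (w / D * (z ^+ n - x ^+ n)) =
               rho * normc (z ^+ n - x ^+ n) / normc D.
  by rewrite [LHS]normcM [normc (w / D)]normcM normcV mulrAC.
exists (fun z => w / D * (z ^+ n - x ^+ n)), y; split => //.
- exact (entireM (entire_cst _)
    (entireD (entireX n entire_id) (entire_cst (- x ^+ n)))).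
- by rewrite subrr mulr0.
- by rewrite divfK.
move=> z; split=> zr; rewrite normf ltr_pdivrMr; [|lra| |lra].
  have : normc (z ^+ n) <= 1 by rewrite normcX exprn_ile1 ?normc_ge0 ?ltW.
  have := normcB (z ^+ n) (x ^+ n); nra.
have : normc (z ^+ n) < d by apply: small; rewrite le_max zr.
have := normcB (z ^+ n) (x ^+ n); nra.
Qed.

(** One step of the construction, F being the composite built so far: F o f is
    almost constant on a large disk, but still takes on X the values that F has
    at x and at y. *)
Lemma pinching_map X x y F (r e : R) :
    subdomain (unit_disk R) X -> ~ relatively_compact_in (unit_disk R) X ->
    entire F -> X x -> X y -> r < 1 -> 0 < e ->
  exists f y', [/\ entire f, forall z, normc z < 1 -> X (f z), X y',
    f x = x /\ f y' = y & forall z, normc z <= r -> normc (F (f z) - F x) < e].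
Proof.
move=> [XD _ oX cX] nrc eF Xx Xy r1 e0.
have [g [w [eg gX w1 g0 gw]]] := disc_link oX cX Xx Xy.
have [d d0 dFg] := entire_continuousP 0 (entire_comp eF eg) e0.
have [p [y' [ep Xy' px py' pr]]] := interpolation XD nrc Xx w1 r1 d0.
exists (g \o p), y'; split; first exact (entire_comp eg ep).
- by move=> z z1; apply/gX/ltW; case: (pr z) => + _; apply.
- exact: Xy'.
- by rewrite /= px py'.
move=> z zr; have := dFg (p z); rewrite subr0 /= g0; apply.
by case: (pr z) => _; apply.
Qed.

Lemma oscillating_ifs X (a b : C) :
    subdomain (unit_disk R) X -> ~ relatively_compact_in (unit_disk R) X ->
    X a -> X b ->
  exists f : nat -> C -> C, (forall n, holomorphic_map (unit_disk R) X (f n)) /\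
    forall n z, normc z <= 1 - n.+1%:R^-1 ->
      normc (ifs f n z - (if odd n then b else a)) < n.+1%:R^-1.
Proof.
move=> sX nrc Xa Xb.
pose c n := if odd n then b else a.
(* A state is a composite F_n with two points of X; [stP] shows that the values
   of F_n at these points are a and b, in an order that alternates with n. *)
pose good (s : (C -> C) * C * C) := [/\ entire s.1.1, X s.1.2 & X s.2].
pose next (s : nat * ((C -> C) * C * C)) (t : (C -> C) * C) :=
  [/\ entire t.1, forall z, normc z < 1 -> X (t.1 z), X t.2,
    t.1 s.2.1.2 = s.2.1.2 /\ t.1 t.2 = s.2.2
    & forall z, normc z <= 1 - s.1.+1%:R^-1 ->
        normc (s.2.1.1 (t.1 z) - s.2.1.1 s.2.1.2) < s.1.+1%:R^-1].
have /choice[h hP] s : exists t, good s.2 -> next s t.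
  have [[eF Xx Xy]|bad] := pselect (good s.2); last by exists (id, 0).
  have [||f [y' fP]] := @pinching_map X s.2.1.2 s.2.2 s.2.1.1
    (1 - s.1.+1%:R^-1) (s.1.+1%:R^-1) sX nrc eF Xx Xy.
  - by rewrite gtrBl invr_gt0 ltr0n.
  - by rewrite invr_gt0 ltr0n.
  by exists (f, y').
pose fix st n : (C -> C) * C * C := if n is m.+1 then
  let t := h (m, st m) in ((st m).1.1 \o t.1, t.2, (st m).1.2) else (id, a, b).
have stP n : [/\ good (st n), (st n).1.1 (st n).1.2 = c n
                            & (st n).1.1 (st n).2 = c n.+1].
  elim: n => [|n [gn an bn]].
    by split => //; split => //; exact: entire_id.
  have [et _ Xt [tx ty] _] := hP (n, st n) gn.
  case: gn => eF Xx Xy; split=> /=.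
  - by split; [exact (entire_comp eF et)| |].
  - by rewrite ty bn.
  - by rewrite tx an /c /= negbK.
pose f n := (h (n, st n)).1.
have ifsE n : ifs f n = (st n.+1).1.1 by elim: n => [//|n /= ->].
exists f; split=> n.
  have [gn _ _] := stP n; have [et tX _ _ _] := hP (n, st n) gn.
  by split=> z => [_|]; [exact: et|rewrite unit_diskE; exact: tX].
have [gn an _] := stP n; have [_ _ _ _ tc] := hP (n, st n) gn.
by move=> z zn; rewrite ifsE -/(c n) -an; exact: tc.
Qed.

Lemma cst_accumulation_point (F : nat -> C -> C) (c : C) (s : nat -> nat) :
    {homo s : m n / (m < n)%N} ->
    (forall n z, normc z <= 1 - (s n).+1%:R^-1 ->
       normc (F (s n) z - c) < (s n).+1%:R^-1) ->
  accumulation_point (unit_disk R) F (fun=> c).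
Proof.
move=> s_mono Fc; split=> [z _|]; first exact: entire_cst.
exists s => // K cK KD U /uniform_nbhs[E [entE EU]].
have [e e0 cE] : exists2 e : R, 0 < e & forall w, normc (w - c) < e -> E (c, w).
  have /nbhs_normcP[e e0 eE] := nbhs_entourage c entE.
  by exists e => // w /eE; rewrite /xsection /= inE.
have sn n : (n <= s n)%N.
  by elim: n => // n IHn; apply: leq_ltn_trans IHn (s_mono _ _ (ltnSn n)).
have le_inv n : (s n).+1%:R^-1 <= n.+1%:R^-1 :> R.
  by rewrite lef_pV2 ?posrE ?ltr0n // ler_nat ltnS.
have := compact_in_disk cK KD; have := near_infty_natSinv_lt (PosNum e0).
apply: filterS2 => n /= ne Kn; apply: EU => z Kz /=; apply: cE.
have := Kn _ Kz; have := Fc n z; have := le_inv n.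
move: ne; set i := n.+1%:R^-1; set j := (s n).+1%:R^-1 => ie ji Fj zi.
apply: lt_trans ie; apply: lt_le_trans (ji); apply: Fj.
by apply: le_trans zi _; rewrite lerD2l lerN2.
Qed.

End Discs.

Theorem theorem1p5 (R : realType) (X : set (Cplane R)) :
  subdomain (unit_disk R) X ->
  ~ relatively_compact_in (unit_disk R) X ->
  exists f : nat -> Cplane R -> Cplane R,
    (forall n, holomorphic_map (unit_disk R) X (f n)) /\
    more_than_one_accumulation_point (unit_disk R) (ifs f).
Proof.
move=> sX nrc; have [_ [a Xa] oX _] := sX.
have [d d0 dX] := open_normcP oX Xa.
pose t : Cplane R := (d / 2)%:C%C.
have Xb : X (a + t).
  by apply: dX; rewrite addrC addKr normc_real ?divr_ge0 ?ltW //; lra.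
have [f [fX fc]] := oscillating_ifs sX nrc Xa Xb.
exists f; split=> //; exists (fun=> a), (fun=> a + t); split.
- apply: (@cst_accumulation_point _ _ _ double) => [m n|n z zn].
    by rewrite ltn_double.
  by have := fc _ z zn; rewrite odd_double.
- apply: (@cst_accumulation_point _ _ _ (fun n => n.*2.+1)) => [m n|n z zn].
    by rewrite ltnS ltn_double.
  by have := fc _ z zn; rewrite /= odd_double.
- exists 0; first by rewrite unit_diskE [normc 0]normc0.
  rewrite -subr_eq0 opprD addNKr oppr_eq0.
  by apply/eqP => -[]; lra.
Qed.
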